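(* Let $t>2$ be an even natural number, $n=2t+1$, and let $i$ be a natural number with $\gcd(i,n)=1$. Then the even Niho exponent $2^t+2^{t/2}-1$ is never cyclotomic equivalent to $e((t+2)/2,i)$ over $\mathbb{F}_{2^n}$.
   Context: For natural numbers $l,k$, $e(l,k)=\sum_{j=0}^{l-1}2^{jk}$. Two exponents $d,e$ are cyclotomic equivalent over $\mathbb{F}_{2^n}$ if there is a natural number $a$ with $2^a d\equiv e\pmod{2^n-1}$, or (when $\gcd(d,2^n-1)=1$) $2^a d^{-1}\equiv e\pmod{2^n-1}$, where $d^{-1}$ is the inverse of $d$ modulo $2^n-1$. *)

(* Defs.v *)
From mathcomp Require Import all_boot.
Set Implicit Arguments.
Unset Strict Implicit.
Unset Printing Implicit Defensive.

Definition e_exp (l k : nat) : nat := \sum_(0 <= j < l) 2 ^ (j * k).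

(* The field GF(2^n) enters only through the order 2 ^ n - 1 of its
   multiplicative group; in the second alternative [d'] is the inverse of [d]
   modulo 2 ^ n - 1, which is unique up to congruence. *)
Definition cyclotomic_equiv (n d e : nat) : Prop :=
  (exists a : nat, 2 ^ a * d = e %[mod 2 ^ n - 1]) \/
  (coprime d (2 ^ n - 1) /\
   exists a d' : nat, d * d' = 1 %[mod 2 ^ n - 1] /\
                      2 ^ a * d' = e %[mod 2 ^ n - 1]).

(* Main.v *)
Require Import Defs.
From mathcomp Require Import all_boot.
From mathcomp Require Import zify.

(* Write t = 2m, n = 4m + 1, d = 2^(2m) + 2^m - 1, and e = e(m + 1, i), so that
   e (2^i - 1) = 2^((m+1)i) - 1.  Multiplying either kind of equivalence by
   2^i - 1 gives a congruence d (2^k - 1) = 2^b - 2^a modulo 2^n - 1: with k = i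
   in the first case, and with k = (m + 1) i in the second, where d e is a power
   of 2.  In both cases n does not divide k.  Such a congruence says that
     2^a + 2^(2m+k) + 2^(m+k) + 1 = 2^b + 2^k + 2^(2m) + 2^m  (mod 2^n - 1),
   and comparing the cyclic binary expansions of both sides, after carrying,
   shows that this is impossible unless n divides k. *)

Lemma sum_pow2_lt (n : nat) (P : pred nat) :
  \sum_(0 <= x < n | P x) 2 ^ x < 2 ^ n.
Proof.
elim: n => [|n IHn]; first by rewrite big_geq.
rewrite big_mkcond big_nat_recr //= -big_mkcond /= expnS.
by case: (P n); lia.
Qed.

(** Uniqueness of binary expansions: the digits below the top one contribute less than its weight,
    so equal sums have equal top digits, and induction does the rest. *)
Lemma sum_pow2_inj (n : nat) (P Q : pred nat) :
  \sum_(0 <= x < n | P x) 2 ^ x = \sum_(0 <= x < n | Q x) 2 ^ x ->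
  forall x, x < n -> P x = Q x.
Proof.
elim: n => [|n IHn] //.
rewrite big_mkcond [RHS]big_mkcond !big_nat_recr //= -!big_mkcond /= => eqPQ x.
have := sum_pow2_lt n P; have := sum_pow2_lt n Q => ltQ ltP.
have PQn : P n = Q n by move: eqPQ; case: (P n); case: (Q n) => //; lia.
rewrite ltnS leq_eqVlt => /orP[/eqP-> // | ltxn].
by apply: IHn => //; move: eqPQ; rewrite PQn; lia.
Qed.

Lemma sum_pow2_predT (n : nat) : \sum_(0 <= x < n) 2 ^ x = 2 ^ n - 1.
Proof.
elim: n => [|n IHn]; first by rewrite big_geq.
by rewrite big_nat_recr //= IHn expnS; have := expn_gt0 2 n; lia.
Qed.

Lemma sum_pow2_seq (n : nat) (s : seq nat) :
  uniq s -> all (fun x => x < n) s ->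
  \sum_(x <- s) 2 ^ x = \sum_(0 <= x < n | x \in s) 2 ^ x.
Proof.
move=> us /allP sn; rewrite -[RHS]big_filter; apply: perm_big.
apply: uniq_perm => // [|x]; first by rewrite filter_uniq ?iota_uniq.
rewrite mem_filter mem_index_iota /=.
by case xs: (x \in s) => //=; rewrite sn.
Qed.

Lemma sum_pow2_seq_lt (n : nat) (s : seq nat) :
  uniq s -> all (fun x => x < n) s -> size s < n ->
  \sum_(x <- s) 2 ^ x < 2 ^ n - 1.
Proof.
move=> us sn szs; rewrite (sum_pow2_seq n) //.
have := sum_pow2_lt n (mem s) => /= lts.
rewrite ltn_neqAle; apply/andP; split; last by lia.
apply/eqP; rewrite -sum_pow2_predT => /sum_pow2_inj all_s.
suff: size (iota 0 n) <= size s by rewrite size_iota leqNgt szs.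
apply: uniq_leq_size; first exact: iota_uniq.
by move=> x; rewrite mem_iota => /= /all_s.
Qed.

(* The hypothesis on sizes rules out the full set of digits, whose sum is
   [2 ^ n - 1], congruent to the empty sum. *)
Lemma sum_pow2_modn_inj (n : nat) (s1 s2 : seq nat) :
  uniq s1 -> all (fun x => x < n) s1 -> size s1 < n ->
  uniq s2 -> all (fun x => x < n) s2 -> size s2 < n ->
  \sum_(x <- s1) 2 ^ x = \sum_(x <- s2) 2 ^ x %[mod 2 ^ n - 1] -> s1 =i s2.
Proof.
move=> u1 l1 z1 u2 l2 z2; rewrite !modn_small ?sum_pow2_seq_lt //.
rewrite !(sum_pow2_seq n) // => /sum_pow2_inj eq12 x.
case: (ltnP x n) => [/eq12 // | lenx].
have notin s : all (fun y => y < n) s -> (x \in s) = false.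
  by move=> /allP ls; apply/negP => /ls; rewrite ltnNge lenx.
by rewrite !notin.
Qed.

Definition cyc_succ (n x : nat) : nat := if x.+1 == n then 0 else x.+1.

Lemma expn_modn_period (n x : nat) : 2 ^ x = 2 ^ (x %% n) %[mod 2 ^ n - 1].
Proof.
have pow1 : 2 ^ n = 1 %[mod 2 ^ n - 1].
  by rewrite -{1}(subnK (expn_gt0 2 n : 1 <= 2 ^ n)) modnDl.
rewrite {1}(divn_eq x n) expnD mulnC [_ %/ _ * _]mulnC expnM.
by rewrite -modnMmr -modnXm pow1 modnXm exp1n modnMmr muln1.
Qed.

Lemma expn_cyc_succ (n x : nat) :
  2 ^ cyc_succ n x = 2 ^ x + 2 ^ x %[mod 2 ^ n - 1].
Proof.
rewrite addnn -mul2n -expnS /cyc_succ; case: eqP => // ->.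
by rewrite [RHS]expn_modn_period modnn.
Qed.

(* Adds the digit [a] to the digit set [s], carrying cyclically; [f] is fuel. *)
Fixpoint add_digit (n f a : nat) (s : seq nat) : seq nat :=
  if f is f'.+1 then
    if a \in s then add_digit n f' (cyc_succ n a) (rem a s) else a :: s
  else a :: s.

Definition digits (n : nat) (s : seq nat) : seq nat :=
  foldr (fun a r => add_digit n (size r) a r) [::] s.

(** Fuel [size s] suffices: each carry removes a digit from [s], so when the fuel runs out [s] is
    empty and [a] is a new digit. *)
Lemma add_digitP (n f a : nat) (s : seq nat) :
  0 < n -> size s <= f -> uniq s -> all (fun x => x < n) s -> a < n ->
  let r := add_digit n f a s in
  [/\ uniq r, all (fun x => x < n) r, size r <= (size s).+1
    & \sum_(x <- r) 2 ^ x = 2 ^ a + \sum_(x <- s) 2 ^ x %[mod 2 ^ n - 1]].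
Proof.
move=> n0; elim: f a s => [|f IHf] a s /= szs us ls ltan.
  by move: szs; rewrite leqn0 => /nilP->; rewrite /= ltan big_cons.
case: ifP => [as_ | /negbT nas]; last by rewrite /= nas us ltan ls big_cons.
have szr : size (rem a s) = (size s).-1 by rewrite size_rem.
have s0 : 0 < size s by case: (s) as_.
have lr : all (fun x => x < n) (rem a s).
  by apply/allP => x /mem_rem; move/allP: ls; apply.
have lta : cyc_succ n a < n.
  by rewrite /cyc_succ; case: eqP => //; lia.
have szf : size (rem a s) <= f by lia.
have [-> -> szo ->] := IHf _ _ szf (rem_uniq _ us) lr lta.
split=> //; first by rewrite (leq_trans szo) // szr prednK.
rewrite -modnDml expn_cyc_succ modnDml -addnA.
by rewrite (perm_big _ (perm_to_rem as_)) /= big_cons.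
Qed.

Lemma digitsP (n : nat) (s : seq nat) :
  0 < n -> all (fun x => x < n) s ->
  [/\ uniq (digits n s), all (fun x => x < n) (digits n s),
      size (digits n s) <= size s
    & \sum_(x <- digits n s) 2 ^ x = \sum_(x <- s) 2 ^ x %[mod 2 ^ n - 1]].
Proof.
move=> n0; elim: s => [|a s IHs] //= /andP[ltan ls].
have [us ld sz eqs] := IHs ls.
have [-> -> sz' ->] := @add_digitP n _ a _ n0 (leqnn _) us ld ltan.
split=> //; first by lia.
by rewrite big_cons -modnDmr eqs modnDmr.
Qed.

(** Carrying never increases the number of digits, so the normalised lists stay shorter than [n] and
    uniqueness of cyclic expansions applies. *)
Lemma digits_inj (n : nat) (s1 s2 : seq nat) :
  all (fun x => x < n) s1 -> size s1 < n ->
  all (fun x => x < n) s2 -> size s2 < n ->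
  \sum_(x <- s1) 2 ^ x = \sum_(x <- s2) 2 ^ x %[mod 2 ^ n - 1] ->
  perm_eq (digits n s1) (digits n s2).
Proof.
move=> l1 z1 l2 z2 eq12; have n0 : 0 < n by lia.
have [u1 d1 y1 e1] := digitsP _ _ n0 l1.
have [u2 d2 y2 e2] := digitsP _ _ n0 l2.
apply: uniq_perm => //; apply: (@sum_pow2_modn_inj n) => //.
- exact: leq_ltn_trans z1.
- exact: leq_ltn_trans z2.
- by rewrite e1 e2.
Qed.

(** Splits on an equality test only when neither arithmetic refutes it nor a hypothesis confirms it,
    which limits the number of carry patterns. *)
Ltac decide_eq :=
  match goal with
  | |- context [@eq_op _ ?x ?y] =>
    first [ have -> : (x == y) = false by lia
          | have -> : (x == y) = true
              by apply/eqP; (assumption || symmetry; assumption)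
          | case: (x =P y) => [?|_] ]
  end; rewrite /= ?inE /cyc_succ ?eqxx /=.

Ltac drop_false :=
  match goal with
  | |- context [@eq_op _ ?x ?y] => have -> : (x == y) = false by lia
  end.

(** Here [x1] and [x2] stand for the residues of [2 * m + k] and [m + k] modulo [n], given by linear
    conditions so that [lia] can use them. *)
Lemma digits_niho_neq (m n k a b x1 x2 : nat) :
  1 < m -> n = 4 * m + 1 -> 0 < k < n -> a < n -> b < n ->
  x1 < n -> x2 < n ->
  x1 = 2 * m + k \/ x1 + n = 2 * m + k -> x2 = m + k \/ x2 + n = m + k ->
  ~~ perm_eq (digits n [:: a; x1; x2; 0]) (digits n [:: b; k; 2 * m; m]).
Proof.
move=> m1 En k0 an bn x1n x2n X1 X2; apply/negP.
move D1: (digits n [:: a; _; _; _]) => d1.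
move D2: (digits n [:: b; _; _; _]) => d2 eqD.
(* Once the digits are computed, the equality of sizes discards the branches with lists of different
   lengths, and the two inclusions become linear constraints for [lia]. *)
have sub12 : all (mem d2) d1 by apply/allP => x; rewrite (perm_mem eqD).
have sub21 : all (mem d1) d2 by apply/allP => x; rewrite -(perm_mem eqD).
move: (perm_size eqD) sub12 sub21 => {eqD}; move: D2.
(* Once the coincidences within the two families are settled, the negative
   outcomes of the remaining comparisons are not needed. *)
case: (k =P m) => ?; last case: (k =P 2 * m) => ?;
  last case: (x1 =P 0) => ?; last case: (x2 =P 0) => ?.
all: rewrite /digits /cyc_succ /=; repeat decide_eq; move=> <- {d2}.
all: move: D1; rewrite /digits /cyc_succ /=; repeat decide_eq; move=> <- {d1}.
all: rewrite //= !inE => _; repeat drop_false; lia.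
Qed.

Lemma sum_pow2_map_modn (n : nat) (s : seq nat) :
  \sum_(x <- s) 2 ^ x = \sum_(x <- [seq x %% n | x <- s]) 2 ^ x
    %[mod 2 ^ n - 1].
Proof.
elim: s => [|x s IHs]; first by rewrite !big_nil.
by rewrite /= !big_cons -modnDm IHs (expn_modn_period n) modnDm.
Qed.

Lemma niho_mul_expn_sub1 (m n k a b : nat) :
  1 < m -> n = 4 * m + 1 ->
  (2 ^ (2 * m) + 2 ^ m - 1) * 2 ^ k + 2 ^ a
    = 2 ^ (2 * m) + 2 ^ m - 1 + 2 ^ b %[mod 2 ^ n - 1] ->
  n %| k.
Proof.
move=> m1 En eq_d.
have {eq_d} : \sum_(x <- [:: a; 2 * m + k; m + k; 0]) 2 ^ x
            = \sum_(x <- [:: b; k; 2 * m; m]) 2 ^ x %[mod 2 ^ n - 1].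
  rewrite !big_cons !big_nil !addn0 (expnD 2 (2 * m)) (expnD 2 m) expn0.
  set d := _ + _ - 1 in eq_d.
  have Ed : 2 ^ (2 * m) + 2 ^ m = d + 1.
    by rewrite subnK // addn_gt0 expn_gt0.
  have EdK : (2 ^ (2 * m) + 2 ^ m) * 2 ^ k = (d + 1) * 2 ^ k by rewrite Ed.
  rewrite !mulnDl mul1n in EdK.
  rewrite [2 ^ (2 * m) * _ + (_ + 1)]addnA EdK Ed.
  (* Adding [2 ^ k + 1] to both sides of [eq_d] absorbs the [- 1] in [d]. *)
  rewrite (_ : 2 ^ a + _ = d * 2 ^ k + 2 ^ a + (2 ^ k + 1)); last by lia.
  rewrite (_ : 2 ^ b + _ = d + 2 ^ b + (2 ^ k + 1)); last by lia.
  by rewrite -modnDml eq_d modnDml.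
rewrite (sum_pow2_map_modn n) [RHS](sum_pow2_map_modn n) /= => eq_s.
have n0 : 0 < n by lia.
apply: contraT => ndvd; have k0 : 0 < k %% n by rewrite lt0n.
have modE c : c < n -> (c + k) %% n = c + k %% n \/
                       (c + k) %% n + n = c + k %% n.
  move=> ltcn; rewrite -modnDmr; have ltk := ltn_pmod k n0.
  case: (ltnP (c + k %% n) n) => [ltn_ | len]; first by left; rewrite modn_small.
  by right; rewrite -{1}(subnK len) modnDr modn_small; lia.
have lt2m : 2 * m < n by lia.
have ltm : m < n by lia.
have lt4 : 4 < n by lia.
have modL c : c %% n < n by rewrite ltn_pmod.
move: eq_s; rewrite mod0n (modn_small lt2m) (modn_small ltm) => /digits_inj.
rewrite /= !modL lt2m ltm n0 lt4 => /(_ isT isT isT isT).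
apply: contraLR => _.
by apply: digits_niho_neq => //; [rewrite k0 modL | exact: modE | exact: modE].
Qed.

(** The geometric sum e (2^k - 1) = 2^(lk) - 1, written without subtraction. *)
Lemma e_exp_mul (l k : nat) : e_exp l k * 2 ^ k + 1 = e_exp l k + 2 ^ (l * k).
Proof.
rewrite /e_exp; elim: l => [|l IHl]; first by rewrite big_geq.
rewrite big_nat_recr //= mulnDl -expnD mulSn [k + _]addnC; lia.
Qed.

Theorem theorem6 (t n i : nat) (ht : 2 < t) (htev : ~~ odd t)
    (hn : n = 2 * t + 1) (hi : coprime i n) :
  ~ cyclotomic_equiv n (2 ^ t + 2 ^ (t %/ 2) - 1) (e_exp ((t + 2) %/ 2) i).
Proof.
have [m Et] : exists m, t = 2 * m by exists (t %/ 2); lia.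
have -> : t %/ 2 = m by lia.
have -> : (t + 2) %/ 2 = m.+1 by lia.
rewrite Et; have m1 : 1 < m by lia.
have En : n = 4 * m + 1 by lia.
have eE := e_exp_mul m.+1 i.
set d := _ + _ - 1; set e := e_exp _ _ in eE *.
have ndvd j : 0 < j < n -> ~ n %| j * i.
  move=> /andP[j0 jn]; rewrite Gauss_dvdl 1?coprime_sym // => /dvdn_leq.
  by move=> /(_ j0); rewrite leqNgt jn.
case=> [[a de] | [_ [a [d' [dd' d'e]]]]].
- (* 2 ^ (a * n.-1) is the inverse of 2 ^ a *)
  have {de} de : d = 2 ^ (a * n.-1) * e %[mod 2 ^ n - 1].
    rewrite -modnMmr -de modnMmr mulnA -expnD -[_ + a]addnC -mulnS.
    rewrite prednK; last by lia.
    by rewrite -modnMml expn_modn_period modnMl modnMml mul1n.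
  apply: (ndvd 1); first by lia.
  rewrite mul1n.
  (* With c = a(n - 1), d (2^i - 1) = 2^c e (2^i - 1) = 2^(c + (m+1)i) - 2^c. *)
  apply: (@niho_mul_expn_sub1 m n i (a * n.-1) (a * n.-1 + m.+1 * i)) => //.
  rewrite -/d -modnDml -modnMml de modnMml modnDml.
  rewrite -[RHS]modnDml de modnDml -mulnA expnD -mulnDr -eE.
  by rewrite mulnDr muln1.
- have {d' dd' d'e} de : d * e = 2 ^ a %[mod 2 ^ n - 1].
    by rewrite -modnMmr -d'e modnMmr mulnCA -modnMmr dd' modnMmr muln1.
  apply: (ndvd m.+1); first by lia.
  (* Here d (2^((m+1)i) - 1) = d e (2^i - 1) = 2^(a+i) - 2^a. *)
  apply: (@niho_mul_expn_sub1 m n (m.+1 * i) a (a + i)) => //.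
  rewrite -/d -modnDmr -de modnDmr -mulnDr addnC -eE mulnDr muln1 mulnA.
  by rewrite [d + _]addnC expnD -modnDml -modnMml de modnMml modnDml.
Qed.
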